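(* Let $n\ge1$, $\mathfrak{gl}=\mathfrak{gl}(2n+1|2n)$ and $\mathfrak g=\mathfrak{osp}(2n+1|2n)\subset\mathfrak{gl}$ as in the context, with $f=\sum_{i=1}^{2n}F_{i+1,i}$ (viewed in both $\mathfrak g$ and $\mathfrak{gl}$). Let $\kappa:\mathcal V(\overline{\mathfrak{gl}})\to\mathcal V(\bar{\mathfrak g})$ be the differential algebra homomorphism induced by the projection $\mathfrak{gl}=\mathfrak{gl}^{\theta}\oplus\mathfrak{gl}^{-\theta}\to\mathfrak{gl}^\theta=\mathfrak g$, $X\mapsto\frac12(X+\theta(X))$ (so $\overline{X}\mapsto\overline{\tfrac12(X+\theta X)}$), where $\mathfrak{gl}^{\pm\theta}=\{X:\theta(X)=\pm X\}$. If $w\in\mathcal W(\overline{\mathfrak{gl}},f)$, then $\kappa(w)\in\mathcal W(\bar{\mathfrak g},f)$.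
   Context: $\mathfrak{gl}(2n+1|2n)$: index set $I=\{1,\dots,4n+1\}$, $p(i)=0$ for $i$ odd, $p(i)=1$ for $i$ even; matrix units $e_{ij}$ of parity $p(i)+p(j)$, $[e_{ij},e_{kl}]=\delta_{jk}e_{il}-(-1)^{(p(i)+p(j))(p(k)+p(l))}\delta_{il}e_{kj}$, $\operatorname{str}(\sum a_{ij}e_{ij})=\sum(-1)^{p(i)}a_{ii}$, form $(X|Y)=\operatorname{str}(XY)$. Put $i'=4n+2-i$, $\delta_k=1$ if $k\in\{2n+2,2n+4,\dots,4n\}$ and $\delta_k=0$ otherwise. $\theta$ is the linear map (an involutive automorphism of $\mathfrak{gl}$) with $\theta(e_{ij})=(-1)^{p(i)p(j)+p(j)+1+\delta_i+\delta_j}e_{j'i'}$; $F_{ij}=e_{ij}+\theta(e_{ij})$, and $\mathfrak g=\mathfrak{osp}(2n+1|2n)=\operatorname{span}\{F_{ij}\}=\mathfrak{gl}^\theta$, with form the restriction of $\operatorname{str}(XY)$. Gradings: $e_{ij}\in\mathfrak{gl}_{(j-i)/2}$, and $\mathfrak g_j=\mathfrak g\cap\mathfrak{gl}_j$ (so $F_{ij}\in\mathfrak g_{(j-i)/2}$); $f\in\mathfrak g_{-1/2}$ is odd. For $\mathfrak a$ with even supersymmetric invariant form, $\bar{\mathfrak a}$ is a parity-reversed copy ($p(\bar a)=p(a)+1$); $\mathcal V(\bar{\mathfrak a})=S(\mathbb C[D]\otimes\bar{\mathfrak a})$ is the free supercommutative algebra on $D^m\bar a$ with odd derivation $D$ and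 SUSY PVA bracket $\{\bar a{}_\chi\bar b\}=(-1)^{p(a)(p(b)+1)}\overline{[a,b]}+\chi(a|b)$ extended by sesquilinearity $\{Dx{}_\chi y\}=-\chi\{x{}_\chi y\}$, $\{x{}_\chi Dy\}=(-1)^{p(x)+1}(D+\chi)\{x{}_\chi y\}$ and Leibniz $\{x{}_\chi yz\}=(-1)^{(p(x)+1)p(y)}y\{x{}_\chi z\}+\{x{}_\chi y\}z$; $\chi$ odd, supercommuting with $\mathcal V$, $D\chi+\chi D=-2\chi^2$. For a grading $\mathfrak a=\bigoplus_j\mathfrak a_j$ and odd $f\in\mathfrak a_{-1/2}$: $\mathfrak n=\mathfrak a_{>0}$, $\mathfrak p=\mathfrak a_{\le0}$, $\mathfrak J$ = differential ideal of $\mathcal V(\bar{\mathfrak a})$ generated by $\bar n-(f|n)$ ($n\in\mathfrak n$), $\mathcal W(\bar{\mathfrak a},f)=\{w\in\mathcal V(\bar{\mathfrak p}):\{\bar n{}_\chi w\}\in\mathbb C[\chi]\otimes\mathfrak J\ \forall n\in\mathfrak n\}$. *)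

(* Defs.v *)
(* Concrete model of the SUSY PVA V(bar gl(2n+1|2n)) over a field C,
   as finite lists of (coefficient, word) read inside the free supercommutative
   algebra on the generators D^m \bar e_{ij}. *)
From mathcomp Require Import all_boot all_algebra.
From mathcomp Require Import Rstruct.
From mathcomp.real_closed Require Import complex.
Set Implicit Arguments. Unset Strict Implicit. Unset Printing Implicit Defensive.
Import GRing.Theory.
Local Open Scope ring_scope.

Definition CC : fieldType := complex Rdefinitions.R.

(** Index set I = {1,...,4n+1}, encoded 0-based as 'I_(4n+1): index k stands for i = k+1. *)
Definition Nn (n : nat) : nat := (4 * n).+1.
Notation idx n := 'I_(Nn n).

(** p(i) = 0 for i odd, 1 for i even (i = k+1 1-based, so p = odd k). *)
Definition par {n} (k : idx n) : bool := odd k.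
(** delta_i = 1 iff i in {2n+2, 2n+4, ..., 4n}, i.e. k odd and k > 2n. *)
Definition delt {n} (k : idx n) : bool := odd k && (2 * n < k)%N.
Definition pe {n} (i j : idx n) : bool := par i (+) par j.

Definition sgn {C : fieldType} (b : bool) : C := if b then -1 else 1.

Definition glM (C : fieldType) (n : nat) := 'M[C]_(Nn n).
Definition E {C : fieldType} {n} (i j : idx n) : glM C n := delta_mx i j.

Definition strM {C : fieldType} {n} (X : glM C n) : C :=
  \sum_(i < Nn n) sgn (par i) * X i i.
Definition form {C : fieldType} {n} (X Y : glM C n) : C := strM (X *m Y).

Definition brE {C : fieldType} {n} (a b : idx n * idx n) : glM C n :=
  (if a.2 == b.1 then E a.1 b.2 else 0)
  - sgn (pe a.1 a.2 && pe b.1 b.2) *: (if a.1 == b.2 then E b.1 a.2 else 0).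

(** theta(e_ij) = (-1)^{p(i)p(j)+p(j)+1+delta_i+delta_j} e_{j'i'},  i' = 4n+2-i (= rev_ord). *)
Definition thsign {n} (i j : idx n) : bool :=
  (par i && par j) (+) par j (+) true (+) delt i (+) delt j.
Definition thetaM {C : fieldType} {n} (X : glM C n) : glM C n :=
  \matrix_(r, s) (sgn (thsign (rev_ord s) (rev_ord r)) * X (rev_ord s) (rev_ord r)).

Definition Fm {C : fieldType} {n} (i j : idx n) : glM C n := E i j + thetaM (E i j).
Definition fM {C : fieldType} (n : nat) : glM C n :=
  \sum_(k < Nn n | (k < 2 * n)%N) Fm (inord k.+1) k.

Definition osp {C : fieldType} {n} (X : glM C n) : Prop := thetaM X = X.
Definition glAll {C : fieldType} {n} (X : glM C n) : Prop := True.

(** grading: e_ij in gl_{(j-i)/2} *)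
Definition deg_pos {C : fieldType} {n} (X : glM C n) : Prop :=
  forall i j, X i j != 0 -> (i < j)%N.
Definition deg_nonpos {C : fieldType} {n} (X : glM C n) : Prop :=
  forall i j, X i j != 0 -> (j <= i)%N.

(** generator (m, (i,j)) stands for D^m \bar e_ij, of parity p(e_ij) + 1 + m *)
Definition gen (n : nat) := (nat * (idx n * idx n))%type.
Definition pgen {n} (g : gen n) : bool := odd g.1 (+) pe g.2.1 g.2.2 (+) true.
Definition key {n} (g : gen n) : nat := (g.1 * (Nn n * Nn n) + (g.2.1 * Nn n + g.2.2))%N.

Definition word n := seq (gen n).
Definition Vpoly (C : fieldType) n := seq (C * word n).

(** sign of the sorting permutation: product over inversions of (-1)^{p p} *)
Fixpoint inv_sign {n} (w : word n) : bool :=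
  match w with
  | [::] => false
  | g :: w' => foldr (fun h b => ((key h < key g)%N && pgen g && pgen h) (+) b) false w'
               (+) inv_sign w'
  end.
Definition nf {n} (w : word n) : word n := sort (fun g h => (key g <= key h)%N) w.

Definition coef {C : fieldType} {n} (x : Vpoly C n) (mu : word n) : C :=
  \sum_(t <- x) (if (nf t.2 == mu) && uniq [seq g <- t.2 | pgen g]
                 then sgn (inv_sign t.2) * t.1 else 0).
Definition peq {C : fieldType} {n} (x y : Vpoly C n) : Prop :=
  forall mu, coef x mu = coef y mu.

Definition punit {C : fieldType} {n} : Vpoly C n := [:: (1, [::])].
Definition pscale {C : fieldType} {n} (c : C) (x : Vpoly C n) : Vpoly C n :=
  [seq (c * t.1, t.2) | t <- x].
Definition pmul {C : fieldType} {n} (x y : Vpoly C n) : Vpoly C n :=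
  [seq (a.1 * b.1, a.2 ++ b.2) | a <- x, b <- y].

Definition Dgen {n} (g : gen n) : gen n := (g.1.+1, g.2).
Fixpoint Dword {C : fieldType} {n} (w : word n) : Vpoly C n :=
  match w with
  | [::] => [::]
  | g :: w' => (1, Dgen g :: w') :: [seq (sgn (pgen g) * t.1, g :: t.2) | t <- Dword w']
  end.

Definition barX {C : fieldType} {n} (m : nat) (X : glM C n) : Vpoly C n :=
  [seq (X i j, [:: (m, (i, j))]) | i <- enum 'I_(Nn n), j <- enum 'I_(Nn n)].

(** ---------- C[chi] (x) V: c chi^k w, chi odd, chi on the left ---------- *)
Definition cpoly (C : fieldType) n := seq (C * nat * word n).

(** D (chi^k v) = (-1)^k chi^k D v - 2 [k odd] chi^{k+1} v   (from D chi + chi D = -2 chi^2) *)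
Definition Dc {C : fieldType} {n} (x : cpoly C n) : cpoly C n :=
  flatten [seq [seq (sgn (odd t.1.2) * t.1.1 * s.1, t.1.2, s.2) | s <- Dword t.2]
               ++ (if odd t.1.2 then [:: (-2 * t.1.1, t.1.2.+1, t.2)] else [::])
          | t <- x].
Definition DchiC {C : fieldType} {n} (x : cpoly C n) : cpoly C n :=
  Dc x ++ [seq (t.1.1, t.1.2.+1, t.2) | t <- x].

Definition pbar {n} (a : idx n * idx n) : bool := pe a.1 a.2.

(** {\bar e_a _chi \bar e_b} = (-1)^{p(a)(p(b)+1)} \bar{[e_a,e_b]} + chi (e_a|e_b) *)
Definition base {C : fieldType} {n} (a b : idx n * idx n) : cpoly C n :=
  [seq (sgn (pbar a && ~~ pbar b) * t.1, 0%N, t.2) | t <- barX 0 (brE a b)]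
  ++ [:: (form (E a.1 a.2) (E b.1 b.2), 1%N, [::])].

(** {\bar e_a _chi D^m \bar e_b} = (-1)^{m p(a)} (D+chi)^m {\bar e_a _chi \bar e_b}
    (sesquilinearity {x_chi Dy} = (-1)^{p(x)+1}(D+chi){x_chi y}, p(\bar e_a) = p(a)+1) *)
Definition brg {C : fieldType} {n} (a : idx n * idx n) (g : gen n) : cpoly C n :=
  [seq (sgn (odd g.1 && pbar a) * t.1.1, t.1.2, t.2) | t <- iter g.1 DchiC (base a g.2)].

(** Leibniz rule {x_chi y z} = (-1)^{(p(x)+1)p(y)} y{x_chi z} + {x_chi y} z,
    moving chi^k to the left past y costs (-1)^{k p(y)} *)
Fixpoint brw {C : fieldType} {n} (a : idx n * idx n) (w : word n) : cpoly C n :=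
  match w with
  | [::] => [::]
  | g :: w' => [seq (t.1.1, t.1.2, t.2 ++ w') | t <- brg a g]
               ++ [seq (sgn ((pbar a (+) odd t.1.2) && pgen g) * t.1.1, t.1.2, g :: t.2)
                  | t <- brw a w']
  end.
Definition brp {C : fieldType} {n} (a : idx n * idx n) (x : Vpoly C n) : cpoly C n :=
  flatten [seq [seq (s.1 * t.1.1, t.1.2, t.2) | t <- brw a s.2] | s <- x].
Definition brX {C : fieldType} {n} (X : glM C n) (x : Vpoly C n) : cpoly C n :=
  flatten [seq [seq (X i j * t.1.1, t.1.2, t.2) | t <- brp (i, j) x]
          | i <- enum 'I_(Nn n), j <- enum 'I_(Nn n)].

Definition cpart {C : fieldType} {n} (k : nat) (y : cpoly C n) : Vpoly C n :=
  [seq (t.1.1, t.2) | t <- y & t.1.2 == k].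

Definition evalE {C : fieldType} {n} (e : seq (C * seq (nat * glM C n))) : Vpoly C n :=
  flatten [seq pscale t.1 (foldr (fun q acc => pmul (barX q.1 q.2) acc) punit t.2) | t <- e].
(** x lies in V(bar a) = S(C[D] (x) bar a) (subalgebra generated by the D^m \bar X, X in a) *)
Definition inV {C : fieldType} {n} (A : glM C n -> Prop) (x : Vpoly C n) : Prop :=
  exists e : seq (C * seq (nat * glM C n)),
    (forall t, t \in e -> forall q, q \in t.2 -> A q.2) /\ peq x (evalE e).

(** generators of the differential ideal: D^m(\bar X - (f|X)) *)
Definition genJ {C : fieldType} {n} (f : glM C n) (m : nat) (X : glM C n) : Vpoly C n :=
  if m is 0 then barX 0 X ++ [:: (- form f X, [::])] else barX m X.
(** x in J: the differential ideal of V(bar a) generated by \bar X - (f|X), X in n = a_{>0} *)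
Definition inJ {C : fieldType} {n} (A : glM C n -> Prop) (f : glM C n) (x : Vpoly C n) : Prop :=
  exists l : seq (Vpoly C n * nat * glM C n),
    (forall t, t \in l -> inV A t.1.1 /\ A t.2 /\ deg_pos t.2) /\
    peq x (flatten [seq pmul t.1.1 (genJ f t.1.2 t.2) | t <- l]).

Definition inW {C : fieldType} {n} (A : glM C n -> Prop) (f : glM C n) (w : Vpoly C n) : Prop :=
  inV (fun X => A X /\ deg_nonpos X) w /\
  forall X, A X -> deg_pos X -> forall k, inJ A f (cpart k (brX X w)).

Definition kgen {C : fieldType} {n} (g : gen n) : Vpoly C n :=
  barX g.1 ((1 / 2 : C) *: (E g.2.1 g.2.2 + thetaM (E g.2.1 g.2.2))).
Definition kappa {C : fieldType} {n} (x : Vpoly C n) : Vpoly C n :=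
  flatten [seq pscale t.1 (foldr (fun g acc => pmul (kgen g) acc) punit t.2) | t <- x].

(* Main.v *)
Require Import Defs.
From mathcomp Require Import all_boot all_algebra.
From mathcomp Require Import zify ring.
From mathcomp Require Import Rstruct.
From mathcomp.real_closed Require Import complex.
Set Implicit Arguments. Unset Strict Implicit. Unset Printing Implicit Defensive.
Import GRing.Theory.
Local Open Scope ring_scope.

(** Since [theta] is an isometric automorphism, the projection [proj] of gl onto
    its fixed points commutes with the bracket by any [X] in osp, and
    [(X | proj Y) = (X | Y)]. Hence [kappa] commutes with [D] and with the bracket by
    osp; as it also sends [bar n - (f|n)] to [bar (proj n) - (f | proj n)], it maps the
    ideal for gl into the one for osp.

    An element of the superalgebra is studied through its values on functionals on
    words: two lists are [peq] iff every functional with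
    [phi (u g h v) = (-1)^(p(g)p(h)) phi (u h g v)] takes the same value on both. An
    operation is then replaced by its adjoint on functionals, and it is well defined
    modulo [peq] as soon as the adjoint preserves this symmetry. The bracket itself
    needs no such check: its commutation with [kappa] already holds in the free
    associative algebra. *)

(** * Signs as a character of booleans under exclusive or *)

Section Signs.
Variable C : fieldType.
Implicit Types b c : bool.

Lemma sgnD b c : sgn (b (+) c) = sgn b * sgn c :> C.
Proof. by case: b c => [] []; rewrite /sgn /= ?mulrNN ?mulr1 ?mul1r. Qed.

Lemma sgnK b : sgn b * sgn b = 1 :> C.
Proof. by rewrite -sgnD addbb. Qed.

End Signs.

(** * Values of functionals on lists, and linear forms on matrices *)

Section Functionals.
Variables (C : fieldType) (n : nat).
Local Notation W := (word n).
Local Notation I2 := (idx n * idx n)%type.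

Definition ev (phi : W -> C) (x : Vpoly C n) : C := \sum_(t <- x) t.1 * phi t.2.

Definition evc (phi : nat -> W -> C) (y : cpoly C n) : C :=
  \sum_(t <- y) t.1.1 * phi t.1.2 t.2.

(** The linear form with value [F (i, j)] at $e_{ij}$, evaluated at [X]; it replaces every sum over
    generators $D^m\bar e_{ij}$ that makes up [barX m X]. *)
Definition pairing (X : glM C n) (F : I2 -> C) : C := \sum_p X p.1 p.2 * F p.

Lemma eq_ev phi psi x : phi =1 psi -> ev phi x = ev psi x.
Proof. by move=> e; apply: eq_bigr => t _; rewrite e. Qed.

Lemma eq_evc phi psi y : (forall k, phi k =1 psi k) -> evc phi y = evc psi y.
Proof. by move=> e; apply: eq_bigr => t _; rewrite e. Qed.

Lemma eq_pairing X F G : F =1 G -> pairing X F = pairing X G.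
Proof. by move=> e; apply: eq_bigr => t _; rewrite e. Qed.

Lemma ev_nil phi : ev phi [::] = 0.
Proof. exact: big_nil. Qed.

Lemma ev_cat phi x y : ev phi (x ++ y) = ev phi x + ev phi y.
Proof. exact: big_cat. Qed.

Lemma evc_cat phi x y : evc phi (x ++ y) = evc phi x + evc phi y.
Proof. exact: big_cat. Qed.

Lemma ev_flatten_map (T : Type) phi (s : seq T) (f : T -> Vpoly C n) :
  ev phi (flatten (map f s)) = \sum_(t <- s) ev phi (f t).
Proof. by rewrite /ev big_flatten big_map. Qed.

Lemma evc_flatten_map (T : Type) phi (s : seq T) (f : T -> cpoly C n) :
  evc phi (flatten (map f s)) = \sum_(t <- s) evc phi (f t).
Proof. by rewrite /evc big_flatten big_map. Qed.

Lemma ev_linear phi psi c x :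
  ev (fun w => c * phi w + psi w) x = c * ev phi x + ev psi x.
Proof.
rewrite /ev mulr_sumr -big_split; apply: eq_bigr => t _ /=.
by rewrite mulrDr mulrCA.
Qed.

Lemma evD phi psi x : ev (fun w => phi w + psi w) x = ev phi x + ev psi x.
Proof. by rewrite -[ev phi x]mul1r -ev_linear; apply: eq_ev => w; rewrite mul1r. Qed.

Lemma evZ phi c x : ev (fun w => c * phi w) x = c * ev phi x.
Proof. by rewrite /ev mulr_sumr; apply: eq_bigr => t _; rewrite mulrCA. Qed.

Lemma evcZ phi c y : evc (fun k w => c * phi k w) y = c * evc phi y.
Proof. by rewrite /evc mulr_sumr; apply: eq_bigr => t _; rewrite mulrCA. Qed.

Lemma pairingD X F G : pairing X (fun p => F p + G p) = pairing X F + pairing X G.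
Proof. by rewrite /pairing -big_split; apply: eq_bigr => p _; rewrite mulrDr. Qed.

Lemma pairingZ X c F : pairing X (fun p => c * F p) = c * pairing X F.
Proof. by rewrite /pairing mulr_sumr; apply: eq_bigr => p _; rewrite mulrCA. Qed.

Lemma pairing_exchange X Y (F : I2 -> I2 -> C) :
  pairing X (fun p => pairing Y (F p)) = pairing Y (fun q => pairing X (F^~ q)).
Proof.
rewrite /pairing; under eq_bigr do rewrite mulr_sumr.
rewrite exchange_big; apply: eq_bigr => q _; rewrite mulr_sumr.
by apply: eq_bigr => p _; rewrite mulrCA.
Qed.

Lemma ev_pairing X (F : I2 -> W -> C) x :
  ev (fun w => pairing X (F^~ w)) x = pairing X (fun p => ev (F p) x).
Proof.
rewrite /pairing /ev; under eq_bigr do rewrite mulr_sumr.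
rewrite exchange_big; apply: eq_bigr => q _; rewrite mulr_sumr.
by apply: eq_bigr => p _; rewrite mulrCA.
Qed.

Lemma evc_pairing X (F : I2 -> nat -> W -> C) y :
  evc (fun k w => pairing X (fun p => F p k w)) y = pairing X (fun p => evc (F p) y).
Proof.
rewrite /pairing /evc; under eq_bigr do rewrite mulr_sumr.
rewrite exchange_big; apply: eq_bigr => q _; rewrite mulr_sumr.
by apply: eq_bigr => p _; rewrite mulrCA.
Qed.

(** A linear form is determined by its values on the matrix units. Later, [L] is a whole bracket
    formula in one matrix argument. *)
Lemma pairing_lin (L : glM C n -> C) M :
  (forall c X Y, L (c *: X + Y) = c * L X + L Y) ->
  pairing M (fun p => L (E p.1 p.2)) = L M.
Proof.
move=> linL.
have L0 : L 0 = 0 by have := linL (-1) 0 0; rewrite scaler0 addr0 mulN1r addNr.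
rewrite [in RHS](matrix_sum_delta M) pair_bigA /pairing.
by elim/big_rec2: _ => //= p a X _ ->; rewrite linL.
Qed.

Lemma pairingDl X Y F : pairing (X + Y) F = pairing X F + pairing Y F.
Proof. by rewrite /pairing -big_split; apply: eq_bigr => p _; rewrite mxE mulrDl. Qed.

Lemma pairingZl c X F : pairing (c *: X) F = c * pairing X F.
Proof. by rewrite /pairing mulr_sumr; apply: eq_bigr => p _; rewrite mxE mulrA. Qed.

Lemma ev_barX phi m X : ev phi (barX m X) = pairing X (fun p => phi [:: (m, p)]).
Proof.
rewrite /ev /barX /pairing big_allpairs_dep big_enum /=.
by under eq_bigr do rewrite big_enum; rewrite pair_bigA; apply: eq_bigr => -[].
Qed.

End Functionals.

(** * Sorting words and the sign of sorting *)

Section Words.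
Variable n : nat.
Implicit Types (g h : gen n) (u v w : word n).

(** [key] is a base-$(4n+1)$ expansion: the indices are its two low digits and the unbounded $m$ is
    the leading part, so Euclidean division recovers all three. *)
Lemma key_inj : injective (@key n).
Proof.
move=> [m [i j]] [m' [i' j']]; rewrite /key /= => e.
have dvd_eq (N q r q' r' : nat) : (r < N)%N -> (r' < N)%N ->
    (q * N + r = q' * N + r')%N -> q = q' /\ r = r'.
  move=> ltr ltr' eqn; have N0 : (0 < N)%N by apply: leq_trans ltr.
  split; first by have := congr1 (divn^~ N) eqn; rewrite !divnMDl // !divn_small // !addn0.
  by have := congr1 (modn^~ N) eqn; rewrite /= !modnMDl !modn_small.
have lt2 (a b : idx n) : (a * Nn n + b < Nn n * Nn n)%N.
  by apply: (@leq_trans (a.+1 * Nn n)); rewrite ?leq_mul2r ?ltn_ord ?orbT // mulSn; have := ltn_ord b; lia.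
have [-> {e}] := dvd_eq _ _ _ _ _ (lt2 i j) (lt2 i' j') e.
by case/dvd_eq=> // /val_inj -> /val_inj ->.
Qed.

(** Adjacent transpositions generate all permutations: the head of [u] is carried to its place in
    [v], and the rest follows by induction under an arbitrary prefix. *)
Lemma perm_adjacent_ind (R : word n -> word n -> Prop) :
    (forall w, R w w) -> (forall u v w, R u v -> R v w -> R u w) ->
    (forall u g h v, R (u ++ g :: h :: v) (u ++ h :: g :: v)) ->
  forall u v, perm_eq u v -> R u v.
Proof.
move=> Rr Rt Rs.
have front p u g v : R (p ++ g :: u ++ v) (p ++ u ++ g :: v).
  elim: u p => //= h u IH p; apply: Rt (Rs _ _ _ _) _.
  by rewrite -!(cat_rcons h p); apply: IH.
suff gen_p u v : perm_eq u v -> forall p, R (p ++ u) (p ++ v).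
  by move=> u v /gen_p /(_ [::]).
elim: u v => [|g u IH] v uv p; first by move: uv; rewrite perm_sym => /perm_nilP ->.
have gv : g \in v by rewrite -(perm_mem uv) mem_head.
case/splitPr: gv uv => v1 v2; rewrite perm_sym perm_catC /= perm_cons.
rewrite perm_catC perm_sym => uv.
by apply: Rt (front _ _ _ _); rewrite -!(cat_rcons g p); apply: IH.
Qed.

Definition leg : rel (gen n) := fun g h => (key g <= key h)%N.

Lemma leg_trans : transitive leg.
Proof. by move=> y x z; apply: leq_trans. Qed.

Lemma leg_total : total leg.
Proof. by move=> x y; apply: leq_total. Qed.

Lemma leg_anti : antisymmetric leg.
Proof. by move=> x y /anti_leq /key_inj. Qed.

Lemma perm_nf w : perm_eq (nf w) w.
Proof. by rewrite /nf perm_sort. Qed.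

Lemma nf_perm u v : perm_eq u v -> nf u = nf v.
Proof.
by move=> uv; apply/(perm_sortP (leT := leg)) => //;
  [apply: leg_total | apply: leg_trans | apply: leg_anti].
Qed.

Definition odd_uniq w := uniq [seq g <- w | pgen g].

Lemma odd_uniq_perm u v : perm_eq u v -> odd_uniq u = odd_uniq v.
Proof. by move=> uv; apply/perm_uniq/perm_filter. Qed.

(** Parity of the number of inversions between a head [g] and the later letters, counting odd
    letters only. *)
Definition cross g w :=
  foldr (fun h b => ((key h < key g)%N && pgen g && pgen h) (+) b) false w.

Lemma cross_perm g u v : perm_eq u v -> cross g u = cross g v.
Proof.
apply: (perm_adjacent_ind (R := fun u v => cross g u = cross g v)) => //.
  by move=> ? ? ? -> .
by move=> p h h' q; rewrite /cross !foldr_cat /= addbCA.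
Qed.

Lemma inv_sign_cons g w : inv_sign (g :: w) = cross g w (+) inv_sign w.
Proof. by []. Qed.

Lemma perm_swap u g h v : perm_eq (u ++ g :: h :: v) (u ++ h :: g :: v).
Proof. by rewrite perm_cat2l -[g :: h :: v]/([:: g] ++ [:: h] ++ v) perm_catCA. Qed.

(** Only the pair [g], [h] changes its relative order. If the letters differ, exactly one of the two
    orders is an inversion; if they coincide, neither is. *)
Lemma inv_sign_swap u g h v :
  inv_sign (u ++ g :: h :: v) =
  ((g != h) && pgen g && pgen h) (+) inv_sign (u ++ h :: g :: v).
Proof.
elim: u => [|x u IH]; last first.
  by rewrite !cat_cons !inv_sign_cons IH (cross_perm _ (perm_swap u g h v)) addbCA.
rewrite !cat0s !inv_sign_cons /cross /= -/(cross g v) -/(cross h v).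
have -> : (g != h) = (key g < key h)%N (+) (key h < key g)%N.
  by rewrite -(inj_eq key_inj); case: (ltngtP (key g) (key h)).
by case: (key g < _)%N; case: (key h < _)%N; case: (pgen g); case: (pgen h);
  case: (cross g v); case: (cross h v); case: (inv_sign v).
Qed.

Lemma inv_sign_sorted w : sorted leg w -> inv_sign w = false.
Proof.
elim: w => // g w IH s; rewrite inv_sign_cons IH ?(path_sorted s) // addbF.
have /allP := order_path_min leg_trans s.
elim: w {s IH} => //= h w IH le.
rewrite /cross /= -/(cross g w) IH => [|x xw]; last by apply: le; rewrite inE xw orbT.
by have := le h (mem_head _ _); rewrite /leg leqNgt => /negbTE ->.
Qed.

Lemma inv_sign_nf w : inv_sign (nf w) = false.
Proof. exact/inv_sign_sorted/sort_sorted/leg_total. Qed.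

(** Brings a repeated odd letter to the front, where supersymmetry forces a functional to vanish. *)
Lemma odd_dup_perm w : ~~ odd_uniq w ->
  exists g v, pgen g /\ perm_eq w (g :: g :: v).
Proof.
elim: w => // g w IH; rewrite /odd_uniq /=; case pg: (pgen g) => /=.
  rewrite negb_and negbK mem_filter => /orP[/andP[_ gw]|/IH].
    by exists g, (rem g w); split=> //; rewrite perm_cons perm_to_rem.
  case=> h [v [ph wv]]; exists h, (g :: v); split=> //.
  rewrite -(perm_cons g) in wv; apply: perm_trans wv _.
  by rewrite -(perm_catCA [:: h; h] [:: g]).
case/IH=> h [v [ph wv]]; exists h, (g :: v); split=> //.
rewrite -(perm_cons g) in wv; apply: perm_trans wv _.
by rewrite -(perm_catCA [:: h; h] [:: g]).
Qed.

End Words.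

(** * Supersymmetric functionals characterize equality in the free supercommutative algebra *)

Section Supersymmetric.
Variables (C : fieldType) (n : nat).
Hypothesis two_neq0 : (2 : C) != 0.
Implicit Types (phi psi : word n -> C).

Definition ssym phi := forall u g h v,
  phi (u ++ g :: h :: v) = sgn (pgen g && pgen h) * phi (u ++ h :: g :: v).

Lemma eq_opp0 (a : C) : a = - a -> a = 0.
Proof.
by move/eqP; rewrite -subr_eq0 opprK -mulr2n -mulr_natl mulf_eq0 (negbTE two_neq0) /= => /eqP.
Qed.

(** The scalar relating a word to its sorted form in the superalgebra; it is 0 when an odd generator
    is repeated. *)
Definition wsign (w : word n) : C := if odd_uniq w then sgn (inv_sign w) else 0.

Lemma wsign_ssym : ssym wsign.
Proof.
move=> u g h v; rewrite /wsign (odd_uniq_perm (perm_swap u g h v)).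
case: ifP => [U|]; last by rewrite mulr0.
rewrite inv_sign_swap sgnD -andbA; case: eqP => //= e; subst h.
(* For odd [g = h] the two signs would disagree, but such a word repeats an odd letter, which [U]
   excludes. *)
case pg: (pgen g) => //=; move: U; rewrite (odd_uniq_perm (v := g :: g :: u ++ v)).
  by rewrite /odd_uniq /= pg /= inE eqxx.
by rewrite (perm_catCA u [:: g; g] v).
Qed.

Lemma ssym_eq0_perm phi u v : ssym phi -> perm_eq u v -> phi u = 0 -> phi v = 0.
Proof.
move=> sy; apply: (perm_adjacent_ind (R := fun u v => phi u = 0 -> phi v = 0)) => //.
  by move=> a b c ab bc /ab.
by move=> a g h b e; rewrite sy e mulr0.
Qed.

(** Swapping two equal odd letters at the front gives $\phi=-\phi$, and 2 is invertible. *)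
Lemma ssym_dup phi w : ssym phi -> ~~ odd_uniq w -> phi w = 0.
Proof.
move=> sy /odd_dup_perm[g [v [pg wv]]].
apply: (@ssym_eq0_perm _ (g :: g :: v)) => //; first by rewrite perm_sym.
by apply: eq_opp0; have := sy [::] g g v; rewrite pg /= mulN1r.
Qed.

(** [wsign] and [phi] pick up the same sign under an adjacent swap, so their product is invariant
    under permutation and can be computed on the sorted word. *)
Lemma ssym_nf phi w : ssym phi -> phi w = wsign w * phi (nf w).
Proof.
move=> sy; case U: (odd_uniq w); last first.
  by rewrite (ssym_dup sy) ?U // /wsign U mul0r.
have inv : wsign w * phi w = wsign (nf w) * phi (nf w).
  pose R u v := wsign u * phi u = wsign v * phi v.
  apply: (@perm_adjacent_ind _ R) => //; rewrite /R.
  - by move=> ? ? ? ->.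
  - move=> u g h v; rewrite wsign_ssym sy; set s := sgn _.
    by rewrite mulrACA /s sgnK mul1r.
  by rewrite perm_sym perm_nf.
move: inv; rewrite {2}/wsign (odd_uniq_perm (perm_nf w)) U inv_sign_nf mul1r => <-.
by rewrite mulrA /wsign U sgnK mul1r.
Qed.

Lemma coefE (x : Vpoly C n) mu :
  coef x mu = ev (fun w => wsign w * (nf w == mu)%:R) x.
Proof.
apply: eq_bigr => t _; rewrite /wsign -/(odd_uniq t.2).
by case: (nf _ == mu); case: (odd_uniq _) => /=; rewrite ?mulr1 ?mulr0 ?mul0r ?mulr0 // mulrC.
Qed.

Lemma coef_ssym mu : ssym (fun w => wsign w * (nf w == mu)%:R).
Proof. by move=> u g h v; rewrite wsign_ssym mulrA (nf_perm (perm_swap _ _ _ _)). Qed.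

Lemma ev_ssym phi (x : Vpoly C n) (s : seq (word n)) : ssym phi -> uniq s ->
  {subset [seq nf t.2 | t <- x] <= s} ->
  ev phi x = \sum_(mu <- s) coef x mu * phi mu.
Proof.
move=> sy us xs; under eq_bigr do rewrite coefE /ev mulr_suml.
rewrite exchange_big; apply: eq_big_seq => t tx /=.
rewrite (bigD1_seq (nf t.2)) //=; last exact/xs/map_f.
rewrite big1 ?addr0 => [|mu /negbTE]; last by rewrite eq_sym => ->; rewrite !mulr0 mul0r.
by rewrite eqxx mulr1 -mulrA -(ssym_nf _ sy).
Qed.

(** Each coefficient is itself the value of a supersymmetric functional; conversely, by [ev_ssym],
    the value of any such functional is a finite combination of coefficients. *)
Lemma peqP (x y : Vpoly C n) : peq x y <-> forall phi, ssym phi -> ev phi x = ev phi y.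
Proof.
split=> [xy phi sy|xy mu]; last by rewrite !coefE; apply/xy/coef_ssym.
(* A common finite list of monomials supporting both [x] and [y]. *)
pose s := undup ([seq nf t.2 | t <- x] ++ [seq nf t.2 | t <- y]).
rewrite !(@ev_ssym _ _ s) ?undup_uniq //.
- by apply: eq_bigr => mu _; rewrite xy.
- by move=> w wy; rewrite mem_undup mem_cat wy orbT.
by move=> w wx; rewrite mem_undup mem_cat wx.
Qed.

End Supersymmetric.

(** * The involution $\theta$, the projection onto its fixed points, and their effect on grading,
    bracket and form *)

Section Theta.
Variables (C : fieldType) (n : nat).
Hypothesis two_neq0 : (2 : C) != 0.
Local Notation "i ^'" := (@rev_ord (Nn n) i) : ring_scope.
Local Notation form := Defs.form.
Implicit Types (X Y : glM C n) (i j k : idx n).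

Lemma par_rev i : par i^' = par i.
Proof. by rewrite /par /= subSS oddB ?oddM // -ltnS ltn_ord. Qed.

Lemma pe_rev i j : pe j^' i^' = pe i j.
Proof. by rewrite /pe !par_rev addbC. Qed.

Lemma delt_rev i : delt i^' = par i (+) delt i.
Proof.
have := par_rev i; rewrite /delt /par => ->; case oi: (odd i) => //=.
(* In the 0-based encoding the reflection is $k\mapsto 4n-k$. Its fixed point $2n$ is even, so of an
   odd $k$ and its reflection exactly one exceeds $2n$. *)
have := ltn_ord i; have : (i : nat) != (2 * n)%N by apply: contraTneq oi => ->; rewrite oddM.
by rewrite /Nn; case: (ltnP (2 * n)); lia.
Qed.

Lemma thsign_rev i j : thsign j^' i^' = thsign i j.
Proof.
rewrite /thsign !par_rev !delt_rev.
by case: (par i); case: (par j); case: (delt i); case: (delt j).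
Qed.

Lemma thsignC i j : thsign i j = thsign j i (+) pe i j.
Proof.
rewrite /thsign /pe.
by case: (par i); case: (par j); case: (delt i); case: (delt j).
Qed.

(** The cocycle relation of the signs, which makes $-\theta$ a super anti-automorphism of the matrix
    product. *)
Lemma thsign_comp i j k :
  thsign i k = true (+) (pe i j && pe j k) (+) thsign i j (+) thsign j k.
Proof.
rewrite /thsign /pe.
by case: (par i); case: (par j); case: (par k); case: (delt i); case: (delt j);
   case: (delt k).
Qed.

Lemma rev_ord_bij : bijective (@rev_ord (Nn n)).
Proof. exact: Bijective (@rev_ordK _) (@rev_ordK _). Qed.

Lemma thetaMK X : thetaM (thetaM X) = X.
Proof.
apply/matrixP=> i j; rewrite !mxE !rev_ordK mulrA.
by rewrite thsign_rev sgnK mul1r.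
Qed.

Lemma thetaM_linear c X Y : thetaM (c *: X + Y) = c *: thetaM X + thetaM Y.
Proof. by apply/matrixP=> i j; rewrite !mxE mulrDr mulrCA. Qed.

Lemma thetaMD X Y : thetaM (X + Y) = thetaM X + thetaM Y.
Proof. by rewrite -[X]scale1r thetaM_linear !scale1r. Qed.

Lemma thetaMZ c X : thetaM (c *: X) = c *: thetaM X.
Proof. by apply/matrixP=> i j; rewrite !mxE mulrCA. Qed.

Definition proj X : glM C n := (1 / 2 : C) *: (X + thetaM X).

Lemma proj_linear c X Y : proj (c *: X + Y) = c *: proj X + proj Y.
Proof. by apply/matrixP=> i j; rewrite !mxE; ring. Qed.

Lemma osp_proj X : osp (proj X).
Proof. by rewrite /osp /proj thetaMZ thetaMD thetaMK addrC. Qed.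

Definition homog b X := forall i j, X i j != 0 -> pe i j = b.

Lemma homog_E i j : homog (pe i j) (E i j).
Proof. by move=> k l; rewrite mxE; case: andP => [[/eqP -> /eqP ->] //|]; rewrite eqxx. Qed.

Lemma homog_theta b X : homog b X -> homog b (thetaM X).
Proof.
move=> hX i j; rewrite mxE mulf_eq0 negb_or => /andP[_ /hX].
by rewrite pe_rev.
Qed.

Lemma homog_proj b X : homog b X -> homog b (proj X).
Proof.
move=> hX i j; rewrite !mxE mulf_eq0 negb_or => /andP[_].
have [->|/hX //] := eqVneq (X i j) 0; rewrite add0r => nz.
by apply: (homog_theta hX); rewrite mxE.
Qed.

(** $\theta$ moves the $(i,j)$ entry to $(j',i')$, so [proj] keeps any support condition stable
    under this reflection. Both grading conditions are of this kind. *)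
Lemma proj_supp (P : rel nat) X :
  (forall i j, P i^' j^' = P j i) ->
  (forall i j, X i j != 0 -> P i j) -> forall i j, proj X i j != 0 -> P i j.
Proof.
move=> Prev hX i j; rewrite !mxE mulf_eq0 negb_or => /andP[_].
have [->|/hX //] := eqVneq (X i j) 0; rewrite add0r mulf_eq0 negb_or => /andP[_ /hX].
by rewrite Prev.
Qed.

Lemma deg_pos_proj X : deg_pos X -> deg_pos (proj X).
Proof.
move=> hX; apply: (@proj_supp (fun a b => (a < b)%N) X) => // i j.
by move: (ltn_ord i) (ltn_ord j); rewrite /= /Nn; lia.
Qed.

Lemma deg_nonpos_proj X : deg_nonpos X -> deg_nonpos (proj X).
Proof.
move=> hX; apply: (@proj_supp (fun a b => (b <= a)%N) X) => // i j.
by move: (ltn_ord i) (ltn_ord j); rewrite /= /Nn; lia.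
Qed.

(** The supercommutator with the parities as separate parameters, so that it is bilinear in the
    matrices. *)
Definition sbr b c X Y : glM C n := X *m Y - sgn (b && c) *: (Y *m X).

Lemma thetaM_mul b c X Y : homog b X -> homog c Y ->
  thetaM (X *m Y) = - (sgn (b && c) *: (thetaM Y *m thetaM X)).
Proof.
move=> hX hY; apply/matrixP=> r s; rewrite !mxE !mulr_sumr -sumrN.
rewrite (reindex _ (onW_bij _ rev_ord_bij)); apply: eq_bigr => t _ /=.
rewrite !mxE.
(* A nonzero entry reveals the parity of its pair of indices, which is what the cocycle relation
   needs; zero entries contribute nothing. *)
have [->|/hX pX] := eqVneq (X s^' t^') 0; first by rewrite !(mul0r, mulr0) oppr0.
have [->|/hY pY] := eqVneq (Y t^' r^') 0; first by rewrite !(mul0r, mulr0) oppr0.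
rewrite (@thsign_comp _ t^') pX pY !sgnD /sgn /=; ring.
Qed.

(** $\theta$ reverses products up to sign, so it exchanges the two terms of the supercommutator. *)
Lemma thetaM_sbr b c X Y : homog b X -> homog c Y ->
  thetaM (sbr b c X Y) = sbr b c (thetaM X) (thetaM Y).
Proof.
move=> hX hY; rewrite /sbr addrC -scaleNr thetaM_linear.
rewrite (thetaM_mul hX hY) (thetaM_mul hY hX) andbC.
by rewrite scaleNr scalerN opprK scalerA sgnK scale1r.
Qed.

Lemma sbr_linear b c X a Y Z : sbr b c X (a *: Y + Z) = a *: sbr b c X Y + sbr b c X Z.
Proof.
rewrite /sbr mulmxDr mulmxDl -scalemxAr -scalemxAl.
move: (X *m Y) (X *m Z) (Y *m X) (Z *m X) => U V U' V'.
by apply/matrixP=> i j; rewrite !mxE; ring.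
Qed.

Lemma proj_sbr b c X Y : osp X -> homog b X -> homog c Y ->
  sbr b c X (proj Y) = proj (sbr b c X Y).
Proof.
move=> oX hX hY; rewrite /proj (thetaM_sbr hX hY) oX.
have sbr0 : sbr b c X 0 = 0 by rewrite /sbr mulmx0 mul0mx scaler0 subr0.
rewrite -[_ *: (Y + _)]addr0 sbr_linear sbr0 addr0.
by have := sbr_linear b c X 1 Y (thetaM Y); rewrite !scale1r => ->.
Qed.

(** After reindexing by the reflection, the signs of the $(t,s)$ and $(s,t)$ entries differ by
    $p(s)+p(t)$, which turns the supertrace sign at $s$ into the one at $t$. *)
Lemma form_thetaM X Y : form (thetaM X) (thetaM Y) = form X Y.
Proof.
rewrite /form /strM; under eq_bigr do rewrite mxE mulr_sumr.
under [in RHS]eq_bigr do rewrite mxE mulr_sumr.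
rewrite exchange_big (reindex _ (onW_bij _ rev_ord_bij)); apply: eq_bigr => t _ /=.
rewrite (reindex _ (onW_bij _ rev_ord_bij)); apply: eq_bigr => s _ /=.
rewrite !mxE !rev_ordK par_rev [thsign s t]thsignC sgnD /pe sgnD.
set a := thsign t s.
transitivity ((sgn a * sgn a) * (sgn (par s) * sgn (par s)) * (sgn (par t) * (X t s * Y s t))).
  by ring.
by rewrite !sgnK !mul1r.
Qed.

Lemma form_linear X a Y Z : form X (a *: Y + Z) = a * form X Y + form X Z.
Proof.
rewrite /form mulmxDr -scalemxAr /strM mulr_sumr -big_split; apply: eq_bigr => i _ /=.
by rewrite !mxE; ring.
Qed.

Lemma form_linearl X a Y Z : form (a *: Y + Z) X = a * form Y X + form Z X.
Proof.
rewrite /form mulmxDl -scalemxAl /strM mulr_sumr -big_split; apply: eq_bigr => i _ /=.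
by rewrite !mxE; ring.
Qed.

(** For $\theta X=X$, invariance gives $(X|\theta Y)=(\theta X|\theta Y)=(X|Y)$, so averaging over
    $\theta$ changes nothing. *)
Lemma form_proj X Y : osp X -> form X (proj Y) = form X Y.
Proof.
move=> oX; have f0 : form X 0 = 0.
  by have := form_linear X (-1) 0 0; rewrite scaler0 addr0 mulN1r addNr.
rewrite /proj -[_ *: _]addr0 form_linear f0 addr0.
rewrite -[Y in Y + _]scale1r form_linear -{2}oX form_thetaM.
by field.
Qed.

Lemma osp_Fm i j : osp (Fm i j : glM C n).
Proof. by rewrite /osp /Fm thetaMD thetaMK addrC. Qed.

Lemma osp_fM : osp (fM n : glM C n).
Proof.
rewrite /osp /fM.
elim/big_rec: _ => [|k X _ oX]; last by rewrite thetaMD oX osp_Fm.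
by apply/matrixP=> i j; rewrite !mxE mulr0.
Qed.

Lemma brE_sbr (a b : idx n * idx n) :
  brE a b = sbr (pe a.1 a.2) (pe b.1 b.2) (E a.1 a.2) (E b.1 b.2) :> glM C n.
Proof.
rewrite /brE /sbr /E !mul_delta_mx_cond (eq_sym b.2).
by case: (a.2 == _); case: (a.1 == _).
Qed.

End Theta.

(** * The adjoint of [kappa]: well-definedness and multiplicativity *)

Section Adjoints.
Variables (C : fieldType) (n : nat).
Hypothesis two_neq0 : (2 : C) != 0.
Local Notation W := (word n).
Local Notation I2 := (idx n * idx n)%type.
Implicit Types (phi psi : W -> C) (Phi Psi : nat -> W -> C) (X Y : glM C n)
  (x : Vpoly C n).

Definition projE (p : I2) : glM C n := proj (E p.1 p.2).

(** Only matrix units of parity [b] contribute, so signs depending on the parity of the summation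
    index become constants. *)
Lemma eq_pairing_homog b X (F G : I2 -> C) : homog b X ->
  (forall p, pe p.1 p.2 = b -> F p = G p) -> pairing X F = pairing X G.
Proof.
move=> hX FG; apply: eq_bigr => p _.
by have [->|/hX/FG ->] := eqVneq (X p.1 p.2) 0; rewrite ?mul0r.
Qed.

Lemma homog_projE p : homog (pe p.1 p.2) (projE p).
Proof. exact/homog_proj/homog_E. Qed.

Lemma pairing_projE X (F : I2 -> C) :
  pairing X (fun p => pairing (projE p) F) = pairing (proj X) F.
Proof.
apply: (pairing_lin (L := fun Y => pairing (proj Y) F)) => c Y Z.
by rewrite proj_linear pairingDl pairingZl.
Qed.

Definition kword (w : W) : Vpoly C n := foldr (fun g acc => pmul (kgen g) acc) punit w.

Definition adjK phi w := ev phi (kword w).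

Lemma ev_exchange (F : W -> W -> C) (x y : Vpoly C n) :
  ev (fun a => ev (F a) y) x = ev (fun b => ev (F^~ b) x) y.
Proof.
rewrite /ev; under eq_bigr do rewrite mulr_sumr.
rewrite exchange_big; apply: eq_bigr => t _; rewrite mulr_sumr.
by apply: eq_bigr => s _; rewrite mulrCA.
Qed.

Lemma ev_pmul phi (x y : Vpoly C n) :
  ev phi (pmul x y) = ev (fun a => ev (fun b => phi (a ++ b)) y) x.
Proof.
rewrite /ev /pmul big_allpairs_dep /=; apply: eq_bigr => t _; rewrite mulr_sumr.
by apply: eq_bigr => s _; rewrite /= mulrA.
Qed.

Lemma ev_pmul_barX phi m X x :
  ev phi (pmul (barX m X) x) = pairing X (fun p => ev (fun w => phi ((m, p) :: w)) x).
Proof.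
by rewrite ev_pmul ev_barX.
Qed.

Lemma ev_punit phi : ev phi punit = phi [::].
Proof. by rewrite /ev big_seq1 mul1r. Qed.

Lemma adjK_nil phi : adjK phi [::] = phi [::].
Proof. exact: ev_punit. Qed.

Lemma adjK_cons phi g w :
  adjK phi (g :: w) =
  pairing (projE g.2) (fun p => adjK (fun u => phi ((g.1, p) :: u)) w).
Proof. exact: ev_pmul_barX. Qed.

Lemma eq_adjK phi psi : phi =1 psi -> adjK phi =1 adjK psi.
Proof. by move=> e w; apply: eq_ev. Qed.

Lemma adjK_cat phi u v :
  adjK phi (u ++ v) = adjK (fun u' => adjK (fun v' => phi (u' ++ v')) v) u.
Proof.
elim: u phi => [|g u IH] phi; first by rewrite adjK_nil.
by rewrite cat_cons !adjK_cons; apply: eq_pairing => p; rewrite IH.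
Qed.

Lemma ev_pscale phi c x : ev phi (pscale c x) = c * ev phi x.
Proof. by rewrite /ev big_map mulr_sumr; apply: eq_bigr => t _; rewrite mulrA. Qed.

Lemma ev_kappa phi x : ev phi (kappa x) = ev (adjK phi) x.
Proof. by rewrite ev_flatten_map; apply: eq_bigr => t _; rewrite ev_pscale. Qed.

(** [proj] preserves parity, so exchanging two letters costs the same sign before and after [kappa];
    hence [kappa] respects [peq]. *)
Lemma adjK_ssym phi : ssym phi -> ssym (adjK phi).
Proof.
move=> sy u g h v; elim: u phi sy => [|x u IH] phi sy; last first.
  rewrite !cat_cons !adjK_cons -pairingZ; apply: eq_pairing => p.
  by apply: IH => u' g' h' v'; apply: (sy ((x.1, p) :: u')).
rewrite !cat0s !adjK_cons.
under eq_pairing do rewrite adjK_cons.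
under [in RHS]eq_pairing do rewrite adjK_cons.
rewrite pairing_exchange -pairingZ; apply: (eq_pairing_homog (@homog_projE _)) => q hq.
rewrite -pairingZ; apply: (eq_pairing_homog (@homog_projE _)) => p hp.
rewrite /adjK -evZ; apply: eq_ev => w; rewrite (sy [::]) /= /pgen /=.
by rewrite hp hq.
Qed.

Lemma kappa_peq (x y : Vpoly C n) : peq x y -> peq (kappa x) (kappa y).
Proof.
move/(peqP two_neq0) => xy; apply/(peqP two_neq0) => phi /adjK_ssym sy.
by rewrite !ev_kappa; apply: xy.
Qed.

(** [kappa] sends a product of $D^m\bar X$ to the product of the
    $D^m\overline{\mathrm{proj}\,X}$. *)
Lemma ev_foldr_barX phi (l : seq (nat * glM C n)) :
  ev (adjK phi) (foldr (fun q acc => pmul (barX q.1 q.2) acc) punit l) =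
  ev phi (foldr (fun q acc => pmul (barX q.1 q.2) acc) punit
    [seq (q.1, proj q.2) | q <- l]).
Proof.
elim: l phi => [|q l IH] phi /=; first by rewrite !ev_punit adjK_nil.
rewrite !ev_pmul_barX -pairing_projE.
apply: eq_pairing => p /=; rewrite -(eq_pairing _ (fun p => IH _)).
by rewrite -ev_pairing; apply: eq_ev => w; rewrite adjK_cons.
Qed.

Lemma ev_kappa_pmul phi (x y : Vpoly C n) :
  ev phi (kappa (pmul x y)) = ev phi (pmul (kappa x) (kappa y)).
Proof.
rewrite ev_kappa !ev_pmul ev_kappa; apply: eq_ev => a.
rewrite (eq_ev _ (fun b => adjK_cat phi a b)) /adjK ev_exchange.
by apply: eq_ev => a'; rewrite ev_kappa.
Qed.

Lemma inV_kappa (A B : glM C n -> Prop) x :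
  (forall X, A X -> B (proj X)) -> inV A x -> inV B (kappa x).
Proof.
move=> AB [e [Ae xe]].
exists [seq (t.1, [seq (q.1, proj q.2) | q <- t.2]) | t <- e]; split.
  by move=> _ /mapP[t te ->] _ /mapP[q qt ->] /=; apply/AB/(Ae t).
apply/(peqP two_neq0) => phi sy; rewrite ev_kappa.
rewrite ((peqP two_neq0 _ _).1 xe _ (adjK_ssym sy)) /evalE -map_comp !ev_flatten_map.
by apply: eq_bigr => t _; rewrite !ev_pscale ev_foldr_barX.
Qed.

(** * The adjoints of $D$ and $D+\chi$ commute with that of [kappa] *)

Definition adjD phi w := ev phi (Dword w).

Lemma adjD_cons phi g w :
  adjD phi (g :: w) =
  phi (Dgen g :: w) + sgn (pgen g) * adjD (fun u => phi (g :: u)) w.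
Proof.
rewrite /adjD /ev big_cons big_map mul1r mulr_sumr; congr (_ + _).
by apply: eq_bigr => t _ /=; rewrite mulrA.
Qed.

Lemma eq_adjD phi psi : phi =1 psi -> adjD phi =1 adjD psi.
Proof. by move=> e w; apply: eq_ev. Qed.

(** $D$ changes only the order $m$ of a generator and [kappa] only its matrix unit, while parity,
    and so the Leibniz sign, is kept. *)
Lemma adjK_adjD phi w : adjK (adjD phi) w = adjD (adjK phi) w.
Proof.
elim: w phi => [|g w IH] phi; first by rewrite adjK_nil /adjD !ev_nil.
rewrite adjK_cons adjD_cons adjK_cons /= (eq_adjD (adjK_cons phi g)).
rewrite /adjD ev_pairing -pairingZ -pairingD.
apply: (eq_pairing_homog (@homog_projE _)) => p hp.
rewrite -[ev _ (Dword w)]/(adjD _ w) -IH /adjK -evZ -evD.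
by apply: eq_ev => u; rewrite -/(adjD phi _) adjD_cons /pgen /= hp.
Qed.

(** The transpose of $D+\chi$ at $\chi^k w$, acting on families with one functional per power of
    $\chi$. *)
Definition adjDchi Phi k w : C :=
  sgn (odd k) * adjD (Phi k) w + (if odd k then - 2 * Phi k.+1 w else 0) + Phi k.+1 w.

Lemma evc_DchiC Phi y : evc Phi (DchiC y) = evc (adjDchi Phi) y.
Proof.
rewrite /DchiC evc_cat evc_flatten_map /evc big_map -big_split; apply: eq_bigr => t _ /=.
rewrite big_cat big_map /adjDchi /adjD /ev !mulrDr mulrA mulr_sumr; congr (_ + _ + _).
  by apply: eq_bigr => s _ /=; ring.
by case: odd; rewrite ?big_seq1 ?big_nil ?mulr0 //=; ring.
Qed.

Definition adjKc Phi k := adjK (Phi k).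

Lemma eq_adjDchi Phi Psi : (forall k, Phi k =1 Psi k) ->
  forall k, adjDchi Phi k =1 adjDchi Psi k.
Proof. by move=> e k w; rewrite /adjDchi (eq_adjD (e k)) e. Qed.

Lemma adjK_adjDchi Phi k w : adjK (adjDchi Phi k) w = adjDchi (adjKc Phi) k w.
Proof.
rewrite /adjDchi /adjKc -adjK_adjD /adjK !evD evZ; congr (_ * _ + _ + _).
by case: odd; [rewrite evZ | rewrite /ev big1 // => t _; rewrite mulr0].
Qed.

Lemma evc_iter_DchiC Phi m y : evc Phi (iter m DchiC y) = evc (iter m adjDchi Phi) y.
Proof. by elim: m Phi => //= m IH Phi; rewrite evc_DchiC IH -iterSr. Qed.

Lemma adjK_iter_adjDchi Phi m k w :
  adjK (iter m adjDchi Phi k) w = iter m adjDchi (adjKc Phi) k w.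
Proof.
elim: m k w => //= m IH k w; rewrite adjK_adjDchi.
by apply: eq_adjDchi => j u; rewrite /adjKc IH.
Qed.

End Adjoints.

(** * The bracket by a homogeneous element of osp commutes with [kappa] *)

Section Bracket.
Variables (C : fieldType) (n : nat).
Hypothesis two_neq0 : (2 : C) != 0.
Local Notation W := (word n).
Local Notation I2 := (idx n * idx n)%type.
Local Notation form := Defs.form.
Implicit Types (phi psi : W -> C) (Phi Psi : nat -> W -> C) (X Y : glM C n)
  (g : gen n).

Lemma sbr_linearl b c a Y Z X : sbr b c (a *: Y + Z) X = a *: sbr b c Y X + sbr b c Z X.
Proof.
rewrite /sbr mulmxDr mulmxDl -scalemxAr -scalemxAl.
move: (Y *m X) (Z *m X) (X *m Y) (X *m Z) => U V U' V'.
by apply/matrixP=> i j; rewrite !mxE; ring.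
Qed.

Lemma evc_base Phi (a b : I2) :
  evc Phi (base a b) =
  sgn (pbar a && ~~ pbar b) * pairing (brE a b) (fun p => Phi 0%N [:: (0%N, p)])
  + form (E a.1 a.2) (E b.1 b.2) * Phi 1%N [::].
Proof.
rewrite /base evc_cat /evc big_seq1 big_map /= -ev_barX /ev mulr_sumr; congr (_ + _).
by apply: eq_bigr => t _; rewrite mulrA.
Qed.

Lemma ev_evc_exchange (F : nat -> W -> W -> C) x (y : cpoly C n) :
  ev (fun v => evc (fun k u => F k u v) y) x = evc (fun k u => ev (F k u) x) y.
Proof.
rewrite /ev /evc; under eq_bigr do rewrite mulr_sumr.
rewrite exchange_big; apply: eq_bigr => t _; rewrite mulr_sumr.
by apply: eq_bigr => s _; rewrite mulrCA.
Qed.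

Definition adjbrg X Phi g := pairing X (fun a => evc Phi (brg a g)).
Definition adjbr X Phi w := pairing X (fun a => evc Phi (brw a w)).

(** Sesquilinearity turns $D^m$ on the second argument into $m$ applications of $D+\chi$, and
    linearity extends the formula from matrix units to [X]. *)
Lemma adjbrgE b X Phi g (Psi := iter g.1 (@adjDchi C n) Phi) : homog b X ->
  adjbrg X Phi g =
  sgn (odd g.1 && b) *
  (sgn (b && ~~ pe g.2.1 g.2.2) *
     pairing (sbr b (pe g.2.1 g.2.2) X (E g.2.1 g.2.2)) (fun p => Psi 0%N [:: (0%N, p)])
   + form X (E g.2.1 g.2.2) * Psi 1%N [::]).
Proof.
move=> hX.
transitivity (pairing X (fun a => sgn (odd g.1 && b) *
   (sgn (b && ~~ pe g.2.1 g.2.2) * pairing (sbr b (pe g.2.1 g.2.2) (E a.1 a.2) (E g.2.1 g.2.2))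
      (fun p => Psi 0%N [:: (0%N, p)]) + form (E a.1 a.2) (E g.2.1 g.2.2) * Psi 1%N [::]))).
  apply: (eq_pairing_homog hX) => a ha.
  rewrite -ha -brE_sbr -/(pbar a) -/(pbar g.2) -evc_base -evc_iter_DchiC -evcZ.
  by rewrite /brg /evc big_map; apply: eq_bigr => t _ /=; ring.
apply: (pairing_lin (L := fun Y => sgn (odd g.1 && b) *
   (sgn (b && ~~ pe g.2.1 g.2.2) * pairing (sbr b (pe g.2.1 g.2.2) Y (E g.2.1 g.2.2))
      (fun p => Psi 0%N [:: (0%N, p)]) + form Y (E g.2.1 g.2.2) * Psi 1%N [::]))).
by move=> c Y Z; rewrite sbr_linearl pairingDl pairingZl form_linearl; ring.
Qed.

(** The one-generator case: the $\chi^0$ term uses that the bracket by [X] commutes with [proj], the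
    $\chi^1$ term that $(X|\mathrm{proj}\,Y)=(X|Y)$. *)
Lemma adjbrg_projE b X Phi m (q : I2) : osp X -> homog b X ->
  pairing (projE C q) (fun p => adjbrg X Phi (m, p)) = adjbrg X (adjKc Phi) (m, q).
Proof.
move=> oX hX; rewrite (adjbrgE _ _ hX) /=.
set Psi := iter m (@adjDchi C n) Phi.
have PsiK k u : iter m (@adjDchi C n) (adjKc Phi) k u = adjK (Psi k) u.
  by rewrite /Psi adjK_iter_adjDchi.
rewrite PsiK adjK_nil.
(* On one-letter words [adjK] is a pairing with [projE], so this factor becomes a pairing with the
   projected bracket. *)
under [X in _ * (_ * X + _)]eq_pairing => p.
  rewrite PsiK adjK_cons /=.
  under eq_pairing => r do rewrite adjK_nil.
  over.
rewrite pairing_projE -(proj_sbr oX hX (@homog_E _ _ _ _)) -(form_proj two_neq0 _ oX).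
transitivity (pairing (projE C q) (fun p => sgn (odd m && b) *
   (sgn (b && ~~ pe q.1 q.2) * pairing (sbr b (pe q.1 q.2) X (E p.1 p.2))
      (fun p => Psi 0%N [:: (0%N, p)]) + form X (E p.1 p.2) * Psi 1%N [::]))).
  apply: (eq_pairing_homog (@homog_projE _ _ _)) => p hp.
  by rewrite (adjbrgE _ _ hX) /= hp.
apply: (pairing_lin (L := fun Y => sgn (odd m && b) *
   (sgn (b && ~~ pe q.1 q.2) * pairing (sbr b (pe q.1 q.2) X Y)
      (fun p => Psi 0%N [:: (0%N, p)]) + form X Y * Psi 1%N [::]))).
by move=> c Y Z; rewrite sbr_linear pairingDl pairingZl form_linear; ring.
Qed.

Lemma adjbr_cons b X Phi g w : homog b X ->
  adjbr X Phi (g :: w) =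
  adjbrg X (fun k u => Phi k (u ++ w)) g
  + adjbr X (fun k u => sgn ((b (+) odd k) && pgen g) * Phi k (g :: u)) w.
Proof.
move=> hX; rewrite /adjbr /adjbrg -pairingD; apply: (eq_pairing_homog hX) => a ha.
rewrite /= evc_cat /evc !big_map; congr (_ + _).
by apply: eq_bigr => t _ /=; rewrite /pbar ha; ring.
Qed.

Lemma eq_adjbr X Phi Psi : (forall k, Phi k =1 Psi k) -> adjbr X Phi =1 adjbr X Psi.
Proof. by move=> e w; apply: eq_pairing => a; apply: eq_evc. Qed.

Lemma eq_adjbrg X Phi Psi : (forall k, Phi k =1 Psi k) -> adjbrg X Phi =1 adjbrg X Psi.
Proof. by move=> e w; apply: eq_pairing => a; apply: eq_evc. Qed.

(** Induction along the Leibniz rule: the bracket hits either the first letter, by the one-generator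
    case, or the tail, by the induction hypothesis. *)
Lemma adjK_adjbr b X Phi w : osp X -> homog b X ->
  adjK (adjbr X Phi) w = adjbr X (adjKc Phi) w.
Proof.
move=> oX hX; elim: w Phi => [|g w IH] Phi.
  rewrite adjK_nil /adjbr; apply: eq_pairing => a /=.
  by rewrite /evc !big_nil.
rewrite adjK_cons (adjbr_cons _ _ _ hX).
have -> : adjbrg X (fun k u => adjKc Phi k (u ++ w)) g =
    pairing (projE C g.2) (fun p =>
      adjK (fun v => adjbrg X (fun k u => Phi k (u ++ v)) (g.1, p)) w).
  (* Applying [kappa] to the tail [w] separately leaves a functional of the bracketed letter alone,
     as the one-generator case requires. *)
  rewrite (@eq_adjbrg _ _ (adjKc (fun k u => adjK (fun v => Phi k (u ++ v)) w))).
    case: g => m q; rewrite -(adjbrg_projE _ _ _ oX hX) /=; apply: eq_pairing => p.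
    rewrite /adjbrg /adjK ev_pairing; apply: eq_pairing => a.
    exact/esym/ev_evc_exchange.
  by move=> k u; rewrite /adjKc adjK_cat.
have -> : adjbr X (fun k u => sgn ((b (+) odd k) && pgen g) * adjKc Phi k (g :: u)) w =
    pairing (projE C g.2) (fun p =>
      adjbr X (adjKc (fun k u => sgn ((b (+) odd k) && pgen g) * Phi k ((g.1, p) :: u))) w).
  rewrite /adjbr pairing_exchange; apply: eq_pairing => a.
  rewrite -evc_pairing; apply: eq_evc => k u.
  rewrite /adjKc adjK_cons -pairingZ; apply: eq_pairing => p.
  by rewrite /adjK evZ.
rewrite -pairingD; apply: (eq_pairing_homog (@homog_projE _ _ _)) => p hp.
rewrite -IH -evD; apply: eq_ev => u.
by rewrite (adjbr_cons _ _ _ hX) /pgen /= hp.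
Qed.

(** * Reduction of a general element of osp to its parity components *)

Definition component b X : glM C n := \matrix_(i, j) (if pe i j == b then X i j else 0).

Lemma component_sum X : X = component true X + component false X.
Proof. by apply/matrixP=> i j; rewrite !mxE; case: pe; rewrite ?addr0 ?add0r. Qed.

Lemma homog_component b X : homog b (component b X).
Proof. by move=> i j; rewrite mxE; case: ifP => [/eqP //|]; rewrite eqxx. Qed.

Lemma osp_component b X : osp X -> osp (component b X).
Proof.
move=> oX; apply/matrixP=> i j; rewrite -{2}oX !mxE pe_rev.
by case: ifP; rewrite ?mulr0.
Qed.

(** The Leibniz signs depend on the parity of [X]; since $\theta$ is even, both components of [X]
    stay in osp and are treated separately. *)
Lemma adjK_adjbr_osp X Phi w : osp X -> adjK (adjbr X Phi) w = adjbr X (adjKc Phi) w.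
Proof.
move=> oX; have split_br Psi u :
    adjbr X Psi u = adjbr (component true X) Psi u + adjbr (component false X) Psi u.
  by rewrite /adjbr -pairingDl -component_sum.
rewrite split_br (eq_adjK (split_br Phi)) /adjK evD.
by congr (_ + _); rewrite -(@adjK_adjbr _ _ _ _ (osp_component _ oX) (@homog_component _ _)).
Qed.

(** * Transfer of the ideal and of the W-algebra along [kappa] *)

Lemma evc_brX X Phi x : evc Phi (brX X x) = ev (adjbr X Phi) x.
Proof.
rewrite ev_pairing /evc /brX big_flatten /= big_allpairs_dep big_enum /=.
under eq_bigr do rewrite big_enum.
rewrite pair_bigA; apply: eq_bigr => -[i j] _ /=.
rewrite big_map /brp big_flatten big_map /ev mulr_sumr; apply: eq_bigr => s _.
by rewrite big_map /evc !mulr_sumr; apply: eq_bigr => t _ /=; ring.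
Qed.

Lemma ev_cpart phi k y :
  ev phi (cpart k y) = evc (fun j w => if j == k then phi w else 0) y.
Proof.
rewrite /ev /evc big_map big_filter big_mkcond; apply: eq_bigr => t _ /=.
by case: eqP; rewrite ?mulr0.
Qed.

Lemma cpart_brX_kappa k X x : osp X ->
  peq (cpart k (brX X (kappa x))) (kappa (cpart k (brX X x))).
Proof.
move=> oX; apply/(peqP two_neq0) => phi _.
rewrite ev_kappa !ev_cpart !evc_brX ev_kappa; apply: eq_ev => w.
rewrite adjK_adjbr_osp //; apply: eq_adjbr => j u; rewrite /adjKc.
by case: eqP => // _; rewrite /adjK /ev big1 // => t _; rewrite mulr0.
Qed.

Lemma inJ_kappa f x : osp f -> inJ (@glAll C n) f x -> inJ (@osp C n) f (kappa x).
Proof.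
move=> osp_f [l [Al xl]].
exists [seq (kappa t.1.1, t.1.2, proj t.2) | t <- l]; split.
  move=> _ /mapP[t /Al [Vt [_ pt]] ->] /=; split; last first.
    by split; [apply: osp_proj | apply: deg_pos_proj].
  by apply: inV_kappa Vt => // X _; apply: osp_proj.
apply/(peqP two_neq0) => phi sy.
rewrite ((peqP two_neq0 _ _).1 (kappa_peq two_neq0 xl) _ sy) ev_kappa.
rewrite -map_comp !ev_flatten_map; apply: eq_bigr => -[[y m] X] _ /=.
rewrite -ev_kappa ev_kappa_pmul !ev_pmul; apply: eq_ev => a.
(* This settles the generators with $m>0$; for $m=0$ there is also the constant $(f|X)$, which
   equals $(f|\mathrm{proj}\,X)$ because [f] is in osp. *)
have evb Y psi : ev (adjK psi) (barX m Y) = ev psi (barX m (proj Y)).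
  rewrite !ev_barX -pairing_projE; apply: eq_pairing => p.
  by rewrite adjK_cons; apply: eq_pairing => q; rewrite adjK_nil.
rewrite ev_kappa; case: m evb => [|m] evb /=; last exact: evb.
rewrite !ev_cat evb (form_proj two_neq0 _ osp_f) /ev !big_seq1 /=.
by rewrite adjK_nil.
Qed.

Lemma inW_kappa f w : osp f -> inW (@glAll C n) f w -> inW (@osp C n) f (kappa w).
Proof.
move=> osp_f [Vw Jw]; split.
  apply: inV_kappa Vw => // X [_ dX].
  by split; [apply: osp_proj | apply: deg_nonpos_proj].
(* A positive element of osp is also a positive element of gl, so the hypothesis on [w] applies to
   this same [X]. *)
move=> X oX dX k; have [l [Al e]] := inJ_kappa osp_f (Jw X I dX k).
by exists l; split=> // mu; rewrite cpart_brX_kappa.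
Qed.

End Bracket.

Theorem mainTheorem7 (n : nat) (hn : (1 <= n)%N) (w : Vpoly CC n) :
  inW (@glAll CC n) (fM n) w -> inW (@osp CC n) (fM n) (kappa w).
Proof.
have two_neq0 : (2 : CC) != 0.
  (* Viewing [CC] as [complex] exposes its numeric structure, which gives characteristic zero. *)
  by rewrite (@Num.Theory.pnatr_eq0 (complex Rdefinitions.R)).
by apply: inW_kappa; last exact: osp_fM.
Qed.
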